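(* Let $m$, $n$ and $q$ be positive integers. Then \[ \sum_{k = 1}^\infty \frac{F_{nk+mnq}}{L_{nk+mnq}\,\prod_{j=0}^{m-1} L_{nk+jnq}^2\,\prod_{j=m+1}^{2m}L_{nk+jnq}^2} = \frac{1}{5F_{2mnq}}\sum_{k=1}^{q}\prod_{j=0}^{2m-1}\frac{1}{L_{nk+jnq}^2}. \]
   Context: The Fibonacci numbers are defined by $F_0=0$, $F_1=1$, $F_n=F_{n-1}+F_{n-2}$, and the Lucas numbers by $L_0=2$, $L_1=1$, $L_n=L_{n-1}+L_{n-2}$. Infinite sums are limits of partial sums. *)

(* Defs.v *)
From mathcomp Require Import all_boot all_order all_algebra.

Set Implicit Arguments.
Unset Strict Implicit.
Unset Printing Implicit Defensive.

Fixpoint fib (n : nat) : nat :=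
  match n with
  | 0 => 0
  | 1 => 1
  | (n''.+1 as n').+1 => fib n' + fib n''
  end.

Fixpoint lucas (n : nat) : nat :=
  match n with
  | 0 => 2
  | 1 => 1
  | (n''.+1 as n').+1 => lucas n' + lucas n''
  end.

(* Main.v *)
(** With [P k] the product of [1 / L_(nk+jnq)^2] over [0 <= j < 2m], shifting [k] by [q] drops
    the factor [j = 0] and adds the factor [j = 2m].  Since
    [L_(a+2b)^2 - L_a^2 = 5 F_(2b) F_(a+b) L_(a+b)], the [k]-th summand is
    [(P k - P (k+q)) / (5 F_(2mnq))], so the series telescopes with step [q]. *)
Require Import Defs.
From mathcomp Require Import all_boot all_order all_algebra.
From mathcomp Require Import all_classical all_reals all_analysis.
From mathcomp Require Import ring zify.
Import Order.TTheory GRing.Theory Num.Theory.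
Import numFieldNormedType.Exports.
Local Open Scope classical_set_scope.
Local Open Scope ring_scope.

Lemma fibSS n : fib n.+2 = (fib n.+1 + fib n)%N. Proof. by []. Qed.
Lemma lucasSS n : lucas n.+2 = (lucas n.+1 + lucas n)%N. Proof. by []. Qed.

(** This is multiplication of [(L_n + F_n sqrt 5) / 2], the [n]-th power of the golden ratio, by the
    ratio itself. As a first-order recurrence on the pair, it allows plain one-step inductions
    below. *)
Lemma fib_lucasS n :
  (2 * fib n.+1 = fib n + lucas n)%N /\ (2 * lucas n.+1 = lucas n + 5 * fib n)%N.
Proof.
elim: n => [//|n [IHf IHl]]; move: (fibSS n) (lucasSS n); lia.
Qed.

Lemma fib_gt0 n : (0 < n)%N -> (0 < fib n)%N.
Proof.
case: n => // n _; elim: n => [//|n IHn]; rewrite fibSS; lia.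
Qed.

Lemma lucas_gt0 n : (0 < lucas n)%N.
Proof. by case: n => // n; move: (fib_gt0 n.+1) (fib_lucasS n); lia. Qed.

(** Linear growth is crude but enough to make the products in the telescoped tail vanish. *)
Lemma leq_lucas n : (n <= lucas n)%N.
Proof.
suff: (n <= lucas n /\ n.+1 <= lucas n.+1)%N by case.
elim: n => [//|n [IHn IHn1]]; move: (lucasSS n) (lucas_gt0 n); lia.
Qed.

Section FibLucas.

Variable R : numFieldType.
Implicit Types a b : nat.
Local Notation F n := ((fib n)%:R : R).
Local Notation L n := ((lucas n)%:R : R).

Lemma fibSr n : F n.+1 = (F n + L n) / 2.
Proof.
apply: (canRL (mulfK _)); first by rewrite pnatr_eq0.
by rewrite -natrM mulnC (fib_lucasS n).1 natrD.
Qed.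

Lemma lucasSr n : L n.+1 = (L n + 5 * F n) / 2.
Proof.
apply: (canRL (mulfK _)); first by rewrite pnatr_eq0.
by rewrite -[5 * _]natrM -natrD -(fib_lucasS n).2 natrM mulrC.
Qed.

(** These are the two coordinates of the product of the [a]-th and [b]-th powers of the golden
    ratio. The induction needs both at once, since each successor step mixes [F] and [L]. *)
Lemma fib_lucasD a b :
  F (a + b) = (F a * L b + L a * F b) / 2 /\
  L (a + b) = (L a * L b + 5 * F a * F b) / 2.
Proof.
elim: b => [|b [IHf IHl]]; first by rewrite addn0 /=; split; field.
by rewrite addnS !fibSr !lucasSr IHf IHl; split; field.
Qed.

Lemma fibD a b : F (a + b) = (F a * L b + L a * F b) / 2.
Proof. exact: (fib_lucasD a b).1. Qed.

Lemma lucasD a b : L (a + b) = (L a * L b + 5 * F a * F b) / 2.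
Proof. exact: (fib_lucasD a b).2. Qed.

(** Up to the factor 4, the left side is the norm of the [n]-th power of the golden ratio, whose own
    norm is -1. *)
Lemma lucas2_sub_fib2 n : L n ^+ 2 - 5 * F n ^+ 2 = 4 * (-1) ^+ n.
Proof.
elim: n => [|n IHn]; first by rewrite /=; ring.
by rewrite fibSr lucasSr [(-1) ^+ _]exprS mulN1r mulrN -IHn; field.
Qed.

(* With [e = (-1)^b], this is the product of [L_(a+2b) + e L_a = L_b L_(a+b)]
   and [L_(a+2b) - e L_a = 5 F_b F_(a+b)]; [field] only needs [e^2 = 1]. *)
Lemma lucas2B a b :
  L (a + 2 * b) ^+ 2 - L a ^+ 2 = 5 * F (2 * b) * F (a + b) * L (a + b).
Proof.
have sgn2 : ((L b ^+ 2 - 5 * F b ^+ 2) / 4) ^+ 2 = 1.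
  by rewrite lucas2_sub_fib2 mulrC mulKf ?pnatr_eq0// sqrr_sign.
have -> : L a ^+ 2 = L a ^+ 2 * ((L b ^+ 2 - 5 * F b ^+ 2) / 4) ^+ 2.
  by rewrite sgn2 mulr1.
by rewrite mul2n -addnn !(fibD, lucasD); field.
Qed.

End FibLucas.

Lemma sum_sub_shift (V : zmodType) (f : nat -> V) q N :
  \sum_(1 <= k < N.+1) (f k - f (k + q)%N) =
  \sum_(1 <= k < q.+1) f k - \sum_(1 <= k < q.+1) f (N + k)%N.
Proof.
elim: N => [|N IHN].
  by rewrite big_geq// (eq_bigr _ (fun i _ => congr1 f (add0n i))) subrr.
(* Going from [N] to [N.+1] slides the window of [q] subtracted terms by one: it gains
   [f (N.+1 + q)] and loses [f N.+1]. *)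
have tele : \sum_(1 <= k < q.+1) (f (N + k.+1)%N - f (N + k)%N) =
    f (N.+1 + q)%N - f N.+1.
  by rewrite telescope_sumr// addnS addn1.
rewrite big_nat_recr//= IHN.
under [X in _ = _ - X]eq_bigr do rewrite addSnnS.
move: tele; rewrite big_split/= sumrN => /(canRL (subrK _)) ->.
by rewrite opprD opprB -addrA [- _ + _]addrC.
Qed.

(** Let [D] be the product of all [g j] with [j <= 2m]. Each product on the left omits one end
    factor, so they are [g (2m) / D] and [g 0 / D]. The middle factor [g m] of [D] is set apart
    because it will partly cancel with the numerator. *)
Lemma prod_inv_sub_shift (K : fieldType) (g : nat -> K) m :
    (forall j, g j != 0) ->
  \prod_(0 <= j < 2 * m) (g j)^-1 - \prod_(0 <= j < 2 * m) (g j.+1)^-1 =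
  (g (2 * m)%N - g 0%N) /
    (g m * ((\prod_(0 <= j < m) g j) * \prod_(m.+1 <= j < (2 * m).+1) g j)).
Proof.
move=> g_neq0; set D := g m * _.
have prod_neq0 a b (h : nat -> nat) : \prod_(a <= j < b) g (h j) != 0.
  by rewrite prodf_seq_neq0; apply/allP => j _; rewrite g_neq0.
have DE : \prod_(0 <= j < (2 * m).+1) g j = D.
  rewrite (big_cat_nat (n := m))//=; last lia.
  by rewrite [X in _ * X]big_ltn 1?mulrCA//; lia.
have DEr : D = (\prod_(0 <= j < 2 * m) g j) * g (2 * m)%N.
  by rewrite -DE big_nat_recr.
have DEl : D = g 0%N * \prod_(0 <= j < 2 * m) g j.+1.
  by rewrite -DE big_nat_recl.
rewrite mulrBl {1}DEr DEl !prodfV; congr (_ - _).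
  by rewrite invfM mulrCA mulfV ?mulr1.
by rewrite invfM mulrA mulfV ?mul1r.
Qed.

Theorem corollary2p43 (R : realType) (m n q : nat)
    (hm : (0 < m)%N) (hn : (0 < n)%N) (hq : (0 < q)%N) :
  (\sum_(1 <= k < N.+1)
     ((fib (n * k + m * n * q))%:R /
      ((lucas (n * k + m * n * q))%:R *
       (\prod_(0 <= j < m) (lucas (n * k + j * n * q))%:R ^+ 2) *
       (\prod_(m.+1 <= j < (2 * m).+1) (lucas (n * k + j * n * q))%:R ^+ 2)) : R))
    @[N --> \oo]
  --> (1 / (5 * (fib (2 * m * n * q))%:R) *
       \sum_(1 <= k < q.+1)
         \prod_(0 <= j < 2 * m) (1 / (lucas (n * k + j * n * q))%:R ^+ 2) : R).
Proof.
pose L i : R := (lucas i)%:R.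
have L_neq0 i : L i != 0 by rewrite pnatr_eq0 -lt0n lucas_gt0.
pose P k : R := \prod_(0 <= j < 2 * m) (1 / L (n * k + j * n * q)%N ^+ 2).
pose c : R := 5 * (fib (2 * m * n * q))%:R.
have c_neq0 : c != 0.
  by rewrite mulf_neq0 ?pnatr_eq0// -lt0n fib_gt0// !muln_gt0 hm hn hq.
have P_cvg0 : P k @[k --> \oo] --> (0 : R).
  (* Only the factor [j = 0] is kept, the others being at most 1. As [harmonic k] is [1 / (k + 1)],
     the bound amounts to [k + 1 <= 2 L_(nk)^2], which follows from [L_(nk) >= k] and
     [L_(nk) >= 1]. *)
  apply: (squeeze_cvgr (f := fun=> 0) (h := fun k => 2 * harmonic k)).
  - apply: nearW => k; apply/andP; split.
      by apply: prodr_ge0 => j _; rewrite div1r invr_ge0 sqr_ge0.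
    rewrite /P big_ltn; last lia.
    rewrite (@le_trans _ _ (1 / L (n * k + 0 * n * q)%N ^+ 2))//.
      apply: ler_piMr; first by rewrite div1r invr_ge0 sqr_ge0.
      apply: prodr_ile1 => j _; rewrite div1r invr_ge0 sqr_ge0/=.
      by rewrite invf_le1 ?exprn_gt0 ?expr_ge1 ?ler1n ?ltr0n ?lucas_gt0.
    rewrite mul0n addn0 ler_pdivrMr ?exprn_gt0 ?ltr0n ?lucas_gt0// mulrAC.
    rewrite ler_pdivlMr ?ltr0n// mul1r -natrX -natrM ler_nat.
    have := leq_lucas (n * k)%N; have := lucas_gt0 (n * k)%N.
    by have := leq_pmull k hn; nia.
  - exact: cvg_cst.
  - rewrite -[X in _ --> X](mulr0 2); apply: cvgMl_tmp.
    exact: cvg_harmonic.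
rewrite (_ : (fun N => \sum_(1 <= k < N.+1) _) = (fun N => c^-1 *
    (\sum_(1 <= k < q.+1) P k - \sum_(1 <= k < q.+1) P (N + k)%N))); last first.
  apply/funext => N; rewrite -sum_sub_shift mulr_sumr; apply: eq_bigr => k _.
  pose g j := L (n * k + j * n * q)%N ^+ 2.
  have -> : P k = \prod_(0 <= j < 2 * m) (g j)^-1.
    by apply: eq_bigr => j _; rewrite div1r.
  (* Adding [q] to [k] adds [nq] to every index, which is the same as raising [j] by one. *)
  have -> : P (k + q)%N = \prod_(0 <= j < 2 * m) (g j.+1)^-1.
    by apply: eq_bigr => j _; rewrite div1r /g; congr (L _ ^- _); lia.
  rewrite prod_inv_sub_shift => [|j]; last by rewrite expf_neq0.
  (* Here [lucas2B] applies with [a = nk] and [b = mnq]; its factor [L_(nk+mnq)] cancels one of the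
     two in [g m]. *)
  have -> : g (2 * m)%N - g 0%N =
      c * (fib (n * k + m * n * q))%:R * L (n * k + m * n * q)%N.
    rewrite /g /L (_ : _ + 2 * m * n * q = n * k + 2 * (m * n * q))%N; last lia.
    by rewrite !mul0n addn0 lucas2B /c !mulnA.
  have prod_neq0 a b : \prod_(a <= j < b) g j != 0.
    by rewrite prodf_seq_neq0; apply/allP => j _; rewrite expf_neq0.
  rewrite -/(L _) -/(g m); move: (prod_neq0 0%N m) (prod_neq0 m.+1 (2 * m).+1)%N.
  rewrite [g m]/g; move: (\prod_(0 <= j < m) _) => A.
  move: (\prod_(m.+1 <= j < _) _) => B A_neq0 B_neq0.
  move: (L_neq0 (n * k + m * n * q)%N) c_neq0; move: (L _) c => Lc d Lc_neq0 d_neq0.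
  by field; apply/and4P; split.
rewrite div1r -/c; apply: cvgMl_tmp; rewrite -[X in _ --> X]subr0.
apply: cvgB; first exact: cvg_cst.
(* The remaining window has a fixed number [q] of terms, so its limit can be taken term by term. *)
rewrite [X in _ --> X](_ : 0 = \sum_(1 <= i < q.+1) 0); last by rewrite big1_eq.
apply: cvg_big => [|i _]; first exact: add_continuous.
by rewrite (cvg_shiftn i P).
Qed.
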